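(* Let $X$ be a finite set of points in $\mathbb{R}^d$, and let $r\ge1$ and $m\ge0$ be integers. If $|X|\ge(d+1)(r-1)+m+1$, then $\mathbf{Tver}(X,r)$ is homologically $(m-1)$-connected, i.e. $\widetilde H_j(\mathbf{Tver}(X,r);\mathbb{Q})=0$ for all $-1\le j\le m-1$.
   Context: $\mathbf{Tver}(X,r)$ is the order complex of the poset of ordered tuples $(X_1,\ldots,X_r)$ of pairwise disjoint (possibly empty) subsets of $X$ with $\bigcap_{i=1}^r\mathrm{conv}(X_i)\neq\emptyset$, ordered by $(X_1,\ldots,X_r)\le(Y_1,\ldots,Y_r)$ iff $X_i\subseteq Y_i$ for all $i$; i.e. its vertices are these tuples and its simplices are the chains. $\widetilde H_{-1}=0$ means the complex has at least one vertex. *)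

(* Defs.v *)
From HB Require Import structures.
From mathcomp Require Import all_boot all_order all_algebra.
From mathcomp Require Import boolp reals.

Set Implicit Arguments.
Unset Strict Implicit.
Unset Printing Implicit Defensive.

Import Order.TTheory GRing.Theory Num.Theory.
Local Open Scope ring_scope.

(* A simplicial complex on the finite vertex type V is given by its face
   predicate K : pred {set V}; the empty face set0 is the unique (-1)-face, so
   the chain complex below is the augmented (reduced) chain complex.  Faces are
   oriented by the fixed total order enum_rank on V. *)

Definition is_chain (V : finType) (K : pred {set V}) (j : int) (c : {set V} -> rat) :=
  forall s, c s != 0 -> (s \in K) /\ (#|s|%:Z = j + 1).

(* simplicial boundary: removing the vertex v from the face v |: tau, whose
   position in the ordered face is the number of vertices of tau below v *)
Definition boundary (V : finType) (c : {set V} -> rat) (tau : {set V}) : rat :=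
  \sum_(v in ~: tau)
     (-1) ^+ #|[set u in tau | (enum_rank u < enum_rank v)%N]| * c (v |: tau).

Definition reduced_homology_trivial (V : finType) (K : pred {set V}) (j : int) : Prop :=
  forall c : {set V} -> rat,
    is_chain K j c -> (forall tau, boundary c tau = 0) ->
    exists b : {set V} -> rat, is_chain K (j + 1) b /\ (forall s, c s = boundary b s).

Definition order_complex (V : finType) (P : pred V) (le : rel V) : pred {set V} :=
  fun s => [forall u in s, P u] && [forall u in s, forall v in s, le u v || le v u].

(* X = {p 0, ..., p (n-1)} is given by an injective family p : 'I_n -> R^d. *)
Definition in_conv (R : realType) (d n : nat) (p : 'I_n -> 'rV[R]_d)
    (S : {set 'I_n}) (x : 'rV[R]_d) : Prop :=
  exists lam : 'I_n -> R,
    [/\ forall k, 0 <= lam k, forall k, k \notin S -> lam k = 0,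
        \sum_k lam k = 1 & x = \sum_k lam k *: p k].

Definition tver_vertex (R : realType) (d n r : nat) (p : 'I_n -> 'rV[R]_d)
    (Y : {ffun 'I_r -> {set 'I_n}}) : bool :=
  [forall i, forall i', (i != i') ==> [disjoint Y i & Y i']] &&
  `[< exists x : 'rV[R]_d, forall i, in_conv p (Y i) x >].

Definition tver_le (n r : nat) : rel {ffun 'I_r -> {set 'I_n}} :=
  fun Y Z => [forall i, Y i \subset Z i].

Definition Tver (R : realType) (d n r : nat) (p : 'I_n -> 'rV[R]_d)
  : pred {set {ffun 'I_r -> {set 'I_n}}} :=
  order_complex (tver_vertex p) (@tver_le n r).

(* Main.v *)
(* Sarkaria's trick turns Tverberg tuples into rainbow subsets, i.e. with at most
   one element of each of the n colours, of a vector configuration in dimension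
   N = (d + 1)(r - 1) whose cone contains 0 nontrivially; each colour class is
   such a capturing set.

   Write R(rho) for the chains of capturing sets with largest member rho, a
   subquotient complex.  Its homology vanishes on chains of size < |rho| - N:
   if rho = v |: rho', then cutting the sets which capture the line spanned by v
   along the two rays of this line (Mayer-Vietoris) and adjoining v to all sets
   deduces R(rho) from R(rho') and from R(rho') in the quotient of dimension
   N - 1.

   To pass to rainbow sets, treat the colours one at a time: if the trace of the
   largest member on one colour class is arbitrary, then adjoining the whole
   class contracts the complex; the part where this trace has at least two
   elements is filtered by complexes which are acyclic one degree further, so
   that the part with trace of size at most one is acyclic as well.  After all
   colours, chains of size < n - N carry no homology. *)
Require Import Defs.
From HB Require Import structures.
From mathcomp Require Import all_boot all_order all_algebra.
From mathcomp Require Import zify ring lra.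
From mathcomp Require Import boolp reals.
Set Implicit Arguments.
Unset Strict Implicit.
Unset Printing Implicit Defensive.
Import Order.TTheory GRing.Theory Num.Theory.
Local Open Scope ring_scope.

(** * Relative acyclicity of families of faces *)

Section Acyclicity.
Variable W : finType.
Implicit Types (s t : {set W}) (v w : W) (c b : {set W} -> rat) (F X : pred {set W}).

(** * Orientation signs and the boundary operator *)

Definition bsign (v : W) (t : {set W}) : rat :=
  (-1) ^+ #|[set u in t | (enum_rank u < enum_rank v)%N]|.

Lemma boundaryE c t :
  boundary c t = \sum_(v | v \notin t) bsign v t * c (v |: t).
Proof. by apply: eq_bigl => v; rewrite inE. Qed.

Lemma bsign_sqr v t : bsign v t * bsign v t = 1.
Proof. by rewrite /bsign -expr2 sqrr_sign. Qed.

Lemma bsign_setU1 v w t : v \notin t ->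
  bsign w (v |: t) = (-1) ^+ (enum_rank v < enum_rank w)%N * bsign w t.
Proof.
move=> vt; rewrite /bsign -exprD; congr (_ ^+ _).
case: ltnP => vw.
  rewrite (_ : [set u in v |: t | _] =
    v |: [set u in t | (enum_rank u < enum_rank w)%N]).
    by rewrite cardsU1 inE (negbTE vt).
  by apply/setP => u; rewrite !inE; case: eqVneq => [->|//]; rewrite vw.
congr #|pred_of_set _|; apply/setP => u; rewrite !inE.
by case: eqVneq => [->|//]; rewrite ltnNge vw /= andbF.
Qed.

Lemma bsign_swap v w t : v \notin t -> w \notin t -> v != w ->
  bsign v t * bsign w (v |: t) = - (bsign w t * bsign v (w |: t)).
Proof.
move=> vt wt vw; rewrite !bsign_setU1 //.
have : (enum_rank v != enum_rank w :> nat).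
  by apply: contra vw => /eqP/val_inj/enum_rank_inj ->.
by case: ltngtP => // _ _; rewrite expr0 expr1; ring.
Qed.

Lemma boundary_boundary c t : boundary (boundary c) t = 0.
Proof.
rewrite boundaryE.
pose G v w := bsign v t * (bsign w (v |: t) * c (w |: (v |: t))).
have -> : \sum_(v | v \notin t) bsign v t * boundary c (v |: t) =
   \sum_(v | v \notin t) \sum_(w | (w \notin t) && (v != w)) G v w.
  apply: eq_bigr => v vt; rewrite boundaryE big_distrr /=.
  by apply: eq_bigl => w; rewrite !inE negb_or andbC eq_sym.
set S := LHS.
suff : S = - S by lra.
rewrite {1}/S (exchange_big_dep (fun w => w \notin t)) /=; last by move=> v w _ /andP[].
rewrite /S -sumrN; apply: eq_bigr => v vt; rewrite -sumrN.
rewrite (eq_bigl (fun w => (w \notin t) && (v != w))); last first.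
  by move=> w; rewrite vt eq_sym.
apply: eq_bigr => w /andP[wt vw].
by rewrite /G !mulrA (bsign_swap vt wt) // setUCA mulNr opprK.
Qed.

Lemma boundaryB c b t :
  boundary (fun s => c s - b s) t = boundary c t - boundary b t.
Proof. by rewrite !boundaryE -sumrB; apply: eq_bigr => v _; rewrite mulrBr. Qed.

Lemma boundaryD c b t :
  boundary (fun s => c s + b s) t = boundary c t + boundary b t.
Proof. by rewrite !boundaryE -big_split; apply: eq_bigr => v _; rewrite mulrDr. Qed.

Lemma boundary_neq0 c t : boundary c t != 0 ->
  exists2 v, v \notin t & c (v |: t) != 0.
Proof.
rewrite boundaryE => /eqP h; apply: contrapT => k; apply: h.
apply: big1 => v vt; have [->|n0] := eqVneq (c (v |: t)) 0; first by rewrite mulr0.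
by case: k; exists v.
Qed.

Definition supported F k c := forall s, c s != 0 -> F s /\ #|s| = k.

Lemma boundary_supp F k c t : supported F k.+1 c -> boundary c t != 0 -> #|t| = k.
Proof.
by move=> sc /boundary_neq0[v vt /sc[_]]; rewrite cardsU1 vt => -[].
Qed.

Lemma supp0 F k c s : supported F k c -> ~~ F s -> c s = 0.
Proof. by move=> sc; apply: contraNeq => /sc[]. Qed.

(* [acyclic F k]: the homology of the quotient complex spanned by the faces in
   F vanishes on faces of cardinality k, i.e. in degree k - 1. *)
Definition acyclic F k := forall c, supported F k c ->
  (forall t, F t -> boundary c t = 0) ->
  exists2 b, supported F k.+1 b & forall s, F s -> c s = boundary b s.

Definition acyclic_below F m := forall k, (k < m)%N -> acyclic F k.

(** Such an [F] is a difference of two simplicial complexes, so that the boundary truncated to [F]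
    still squares to zero. *)
Definition convex_family F :=
  forall s t (u : {set W}), s \subset t -> t \subset u -> F s -> F u -> F t.

Definition restr F c s : rat := if F s then c s else 0.

Lemma restr_supp F F' k c :
  (forall s, c s != 0 -> F s -> F' s /\ #|s| = k) -> supported F' k (restr F c).
Proof. by move=> h s; rewrite /restr; case: ifP; [move=> Fs /h; apply|rewrite eqxx]. Qed.

Lemma restr_boundary F k c t : convex_family F -> supported F k c -> F t ->
  boundary (restr F (boundary c)) t = 0.
Proof.
move=> cF sc Ft; rewrite -[RHS](boundary_boundary c t) !boundaryE.
apply: eq_bigr => v vt; congr (_ * _); rewrite /restr; case: ifPn => // nF.
apply/esym/eqP; apply: contraNT nF => /boundary_neq0[w _ /sc[Fw _]].
by apply: cF Ft Fw; rewrite subsetUr.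
Qed.

Lemma eq_boundary c b t : (forall v, v \notin t -> c (v |: t) = b (v |: t)) ->
  boundary c t = boundary b t.
Proof. by move=> h; rewrite !boundaryE; apply: eq_bigr => v vt; rewrite h. Qed.

(** [X] marks a subcomplex of the relative complex [F]; the faces of [F] outside [X] span the
    quotient. *)
Definition down_in F X := forall s t, s \subset t -> F s -> F t -> X t -> X s.

(** * The long exact sequence of a subcomplex and its quotient *)

Section Split.
Variables (F X : pred {set W}).
Hypotheses (cF : convex_family F) (dX : down_in F X).
Let F1 := [pred s | F s & X s].
Let F2 := [pred s | F s & ~~ X s].

Lemma convex_quot : convex_family F2.
Proof.
move=> s t u st tu /= /andP[Fs Xs] /andP[Fu Xu].
have Ft := cF st tu Fs Fu.
by rewrite Ft; apply: contra Xs; apply: dX.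
Qed.

Let bd_quot k c t : supported F k c -> F2 t ->
  boundary (restr F2 c) t = boundary c t.
Proof.
move=> sc /= /andP[Ft Xt]; apply: eq_boundary => v vt.
rewrite /restr; case: ifPn => //= nF2; apply/esym/eqP.
apply: contraNT nF2 => /sc[Fv _]; rewrite Fv /=.
by apply: contra Xt; apply: dX => //; rewrite subsetUr.
Qed.

Let bd_sub k c t : supported F1 k c -> F t -> ~~ X t -> boundary c t = 0.
Proof.
move=> sc Ft; apply: contraNeq => /boundary_neq0[v vt /sc[/= /andP[Fv Xv] _]].
by apply: dX Xv => //; rewrite subsetUr.
Qed.

Lemma supported_sub k c : supported F1 k c -> supported F k c.
Proof. by move=> sc s /sc[/= /andP[]]. Qed.

Lemma supported_quot k c : supported F2 k c -> supported F k c.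
Proof. by move=> sc s /sc[/= /andP[]]. Qed.

(** Fill the cycle modulo [F1], subtract the boundary of this filling, then fill the remainder,
    which is a cycle of [F1]. *)
Lemma acyclic_ext k : acyclic F1 k -> acyclic F2 k -> acyclic F k.
Proof.
move=> a1 a2 c sc zc.
have [|t F2t|b2 sb2 e2] := a2 (restr F2 c).
- by apply: restr_supp => s /sc[].
- by rewrite (bd_quot sc) //; apply: zc; case/andP: F2t.
have sb2' := supported_quot sb2.
pose c1 s := c s - restr F (boundary b2) s.
have [||b1 sb1 e1] := a1 c1.
- move=> s; rewrite /c1 /restr => n0.
  have [Fs|nFs] := boolP (F s); last first.
    by rewrite (negbTE nFs) subr0 (supp0 sc nFs) eqxx in n0.
  split.
    rewrite /= Fs; apply: contraNT n0 => nX.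
    have F2s : F2 s by rewrite /= Fs.
    by rewrite Fs -(e2 _ F2s) /restr F2s subrr.
  rewrite Fs in n0; have [c0|/sc[]//] := eqVneq (c s) 0.
  rewrite c0 sub0r oppr_eq0 in n0; exact: boundary_supp sb2 n0.
- move=> t /andP[Ft _]; rewrite boundaryB zc // (restr_boundary cF sb2') //.
exists (fun s => b1 s + b2 s).
  move=> s; have [->|/(supported_sub sb1)//] := eqVneq (b1 s) 0.
  by rewrite add0r => /sb2'.
move=> s Fs; rewrite boundaryD; have [Xs|nX] := boolP (X s).
  by rewrite -e1 /= ?Fs // /c1 /restr Fs; ring.
rewrite (bd_sub sb1) // add0r -e2 /= ?Fs // /restr /= Fs nX //.
Qed.

(** A filling in [F] of a cycle of [F1] is a cycle of the quotient one degree up; subtracting the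
    boundary of a filling there moves it into [F1]. *)
Lemma acyclic_sub k : acyclic F k -> acyclic F2 k.+1 -> acyclic F1 k.
Proof.
move=> a a2 c sc zc.
have [|t Ft|b sb e] := a c; first exact: supported_sub.
  have [Xt|nX] := boolP (X t); last exact: bd_sub sc Ft nX.
  by apply: zc; rewrite /= Ft.
have [|t F2t|b2 sb2 e2] := a2 (restr F2 b).
- by apply: restr_supp => s /sb[].
- have := F2t; rewrite (bd_quot sb) // => /= /andP[Ft nX].
  by rewrite -e // (supp0 sc) //= Ft.
have sb2' := supported_quot sb2.
exists (fun s => b s - restr F (boundary b2) s).
  move=> s; rewrite /restr => n0.
  have [Fs|nFs] := boolP (F s); last first.
    by rewrite (negbTE nFs) subr0 (supp0 sb nFs) eqxx in n0.
  split.
    rewrite /= Fs; apply: contraNT n0 => nX.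
    have F2s : F2 s by rewrite /= Fs.
    by rewrite Fs -(e2 _ F2s) /restr F2s subrr.
  rewrite Fs in n0; have [c0|/sb[]//] := eqVneq (b s) 0.
  rewrite c0 sub0r oppr_eq0 in n0; exact: boundary_supp sb2 n0.
move=> s /andP[Fs Xs].
by rewrite boundaryB (restr_boundary cF sb2') // subr0 -e.
Qed.

(** The boundary of a quotient cycle is a cycle of [F1] one degree down; a filling of it in [F1]
    corrects the quotient cycle to a cycle of [F]. *)
Lemma acyclic_quot k : acyclic F k ->
  (forall k', k = k'.+1 -> acyclic F1 k') -> acyclic F2 k.
Proof.
move=> a a1 c sc zc; have sc' := supported_quot sc.
have [c1 sc1 e1] : exists2 c1, supported F1 k c1 &
    forall t, F t -> boundary c t = boundary c1 t.
  case: k a a1 sc sc' => [|k] a a1 sc sc'.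
    exists (fun=> 0) => [s|t Ft]; first by rewrite eqxx.
    have z b : supported F 0 b -> boundary b t = 0.
      move=> sb; apply/eqP; apply: contraT => /boundary_neq0[v vt /sb[_ /eqP]].
      by rewrite cardsU1 vt.
    by rewrite !z // => s; rewrite eqxx.
  have [||c1 sc1 e1] := a1 k erefl (restr F (boundary c)).
  - move=> s; rewrite /restr; case: ifP => [Fs n0|_]; last by rewrite eqxx.
    split; last exact: boundary_supp sc n0.
    rewrite /= Fs; apply: contraNT n0 => nX; rewrite zc //= Fs //.
  - by move=> t /andP[Ft _]; apply: restr_boundary cF sc' Ft.
  exists c1 => // t Ft; have [Xt|nX] := boolP (X t).
    by rewrite -e1 /= ?Ft // /restr Ft.
  by rewrite (bd_sub sc1) // zc //= Ft.
have [|t Ft|b sb e] := a (fun s => c s - c1 s).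
- move=> s; have [->|/sc'//] := eqVneq (c s) 0.
  by rewrite sub0r oppr_eq0 => /(supported_sub sc1).
- by rewrite boundaryB e1 // subrr.
exists (restr F2 b); first by apply: restr_supp => s /sb[].
move=> s F2s; rewrite (bd_quot sb) //; case/andP: (F2s) => Fs nX.
by rewrite -e // (supp0 sc1) ?subr0 //= Fs.
Qed.

Lemma acyclic_below_ext m :
  acyclic_below F1 m -> acyclic_below F2 m -> acyclic_below F m.
Proof. by move=> a1 a2 k km; apply: acyclic_ext; [apply: a1|apply: a2]. Qed.

Lemma acyclic_below_sub m :
  acyclic_below F m -> acyclic_below F2 m.+1 -> acyclic_below F1 m.
Proof. by move=> a1 a2 k km; apply: acyclic_sub; [apply: a1|apply: a2]. Qed.

Lemma acyclic_below_quot m :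
  acyclic_below F m.+1 -> acyclic_below F1 m -> acyclic_below F2 m.+1.
Proof.
move=> a1 a2 k km; apply: acyclic_quot; first exact: a1.
by move=> k' kE; apply: a2; rewrite -kE -ltnS kE in km *.
Qed.

End Split.

Lemma eq_acyclic_below F F' m : F =1 F' -> acyclic_below F m -> acyclic_below F' m.
Proof. by move/funext->. Qed.

Lemma acyclic_below_le F m m' : (m <= m')%N -> acyclic_below F m' -> acyclic_below F m.
Proof. by move=> mm a k km; apply: a; apply: leq_trans mm. Qed.

(** Cut a filling of the cycle into a part in [A] and a rest in [B]. The cycle minus the boundary of
    the first part lives in both, so it can be filled in the intersection. *)
Lemma acyclic_below_Mayer_Vietoris F A B m : convex_family F -> down_in F A -> down_in F B ->
  (forall s, F s -> A s || B s) -> acyclic_below F m ->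
  acyclic_below [pred s | [&& F s, A s & B s]] m ->
  acyclic_below [pred s | F s & A s] m.
Proof.
move=> cF dA dB AB aF aI k km c sc zc.
have sc' : supported F k c by apply: supported_sub sc.
have bd t b : F t -> ~~ A t -> supported [pred s | F s & A s] k.+1 b -> boundary b t = 0.
  move=> Ft + sb; apply: contraNeq => /boundary_neq0[v vt /sb[/= /andP[Fv Xv] _]].
  by apply: dA Xv => //; rewrite subsetUr.
have zcF t : F t -> boundary c t = 0.
  move=> Ft; have [At|] := boolP (A t); first by apply: zc; rewrite /= Ft.
  apply: contraNeq => /boundary_neq0[v vt /sc[/= /andP[Fv Xv] _]].
  by apply: dA Xv => //; rewrite subsetUr.
have [b sb e] := aF k km c sc' zcF.
pose bA := restr A b; pose bB s := b s - bA s.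
have sbA : supported [pred s | F s & A s] k.+1 bA.
  by apply: restr_supp => s /sb[/= -> ->] ->.
have sbA' : supported F k.+1 bA by apply: supported_sub sbA.
have sbB : supported [pred s | F s & B s] k.+1 bB.
  move=> s; rewrite /bB /bA /restr; case: ifPn => [_|nA]; first by rewrite subrr eqxx.
  rewrite subr0 => /sb[/= Fs ->]; split=> //; rewrite Fs /=.
  by have := AB s Fs; rewrite (negbTE nA).
pose c' s := c s - restr F (boundary bA) s.
have c'E s : F s -> c' s = boundary bB s.
  by move=> Fs; rewrite /c' /bB boundaryB -e // /restr Fs.
have [||b' sb' e'] := aI k km c'.
- move=> s n0; have [Fs|nF] := boolP (F s); last first.
    by rewrite /c' /restr (negbTE nF) subr0 (supp0 sc' nF) eqxx in n0.
  rewrite /= Fs /=; split; last first.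
    by rewrite c'E // in n0; apply: boundary_supp sbB n0.
  apply/andP; split.
    apply: contraNT n0 => nA; rewrite /c' /restr Fs (bd _ _ Fs nA sbA) subr0.
    by rewrite (supp0 sc) //= Fs.
  rewrite c'E // in n0; have [v vt /sbB[/= /andP[Fv Bv] _]] := boundary_neq0 n0.
  by apply: dB Bv => //; rewrite subsetUr.
- by move=> t /and3P[Ft _ _]; rewrite boundaryB zcF // (restr_boundary cF sbA').
exists (fun s => bA s + b' s).
  move=> s; have [->|/sbA//] := eqVneq (bA s) 0.
  by rewrite add0r => /sb'[/= /and3P[-> -> _] ->].
move=> s /andP[Fs As]; rewrite boundaryD; have [Bs|nB] := boolP (B s).
  by rewrite -e' /= ?Fs ?As // /c' /restr Fs; ring.
have -> : boundary b' s = 0.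
  apply/eqP; apply: contraNT nB => /boundary_neq0[v vt /sb'[/= /and3P[Fv Av Bv] _]].
  by apply: dB Bv => //; rewrite subsetUr.
have : boundary bB s = 0.
  apply/eqP; apply: contraNT nB => /boundary_neq0[v vt /sbB[/= /andP[Fv Bv] _]].
  by apply: dB Bv => //; rewrite subsetUr.
by rewrite -c'E // /c' /restr Fs addr0 => /eqP; rewrite subr_eq0 => /eqP.
Qed.

(** [F] is closed under adding and removing [w], so inserting [w] is a contracting homotopy. *)
Lemma acyclic_cone F w k : (forall s, F (w |: s) = F (s :\ w)) -> acyclic F k.
Proof.
move=> Fw c sc zc.
have FD s : F (s :\ w) = F s.
  have [ws|ws] := boolP (w \in s); first by rewrite -Fw (setUidPr _) ?sub1set.
  by rewrite (setDidPl _) // disjoint_sym disjoints1.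
have FU s : F (w |: s) = F s by rewrite Fw FD.
exists (fun s => if w \in s then bsign w (s :\ w) * c (s :\ w) else 0).
  move=> s; case: ifP => [ws|_]; last by rewrite eqxx.
  rewrite mulf_eq0 negb_or => /andP[_ /sc[]]; rewrite FD => -> <-.
  by split=> //; rewrite (cardsD1 w s) ws.
move=> s Fs; rewrite boundaryE; have [ws|ws] := boolP (w \in s); last first.
  rewrite (bigD1 w) //= setU11 setU1K // mulrA bsign_sqr mul1r big1 ?addr0 //.
  by move=> v /andP[vs vw]; rewrite !inE eq_sym (negbTE vw) (negbTE ws) mulr0.
have sE : w |: (s :\ w) = s by rewrite setD1K.
set t := s :\ w in sE.
have wt : w \notin t by rewrite !inE eqxx.
have Ft : F t by rewrite /t FD.
have := zc _ Ft; rewrite boundaryE (bigD1 w) //= sE => /eqP.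
rewrite addr_eq0 => /eqP h.
have : c s = - (bsign w t * \sum_(i | (i \notin t) && (i != w)) bsign i t * c (i |: t)).
  by rewrite -mulrN -h mulrA bsign_sqr mul1r.
move=> ->; rewrite big_distrr /= -sumrN; apply: eq_big => [v|v].
  by rewrite -sE !inE negb_or andbC.
move=> /andP[vt vw]; rewrite !inE ws orbT.
have -> : (v |: s) :\ w = v |: t.
  apply/setP => u; rewrite !inE; case: (eqVneq u w) => //= ->.
  by rewrite eq_sym (negbTE vw).
have := bsign_swap vt wt vw; rewrite sE => sw.
have q1 := bsign_sqr v t; have q2 := bsign_sqr v s.
rewrite !mulrA -mulNr; congr (_ * _).
transitivity (bsign v s * (bsign v t * (bsign v t * bsign w (v |: t)))).
  by rewrite sw -[LHS]mulr1 -q2; ring.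
by rewrite [X in _ * X]mulrA q1 mul1r.
Qed.

(** Induction on down-closed sets [A] of values of [g]: a value of largest size is split off, its
    fibre being the quotient by the faces over the remaining values. *)
Lemma acyclic_below_filter (Y : finType) F (g : {set W} -> {set Y}) m :
  convex_family F -> {homo g : s t / s \subset t} ->
  (forall a, acyclic_below [pred s | F s & g s == a] m) -> acyclic_below F m.
Proof.
move=> cF mg aF.
pose down (A : {set {set Y}}) := forall a a' : {set Y}, a \subset a' -> a' \in A -> a \in A.
suff h A : down A -> acyclic_below [pred s | F s & g s \in A] m.
  apply: (eq_acyclic_below (F := [pred s | F s & g s \in [set: {set Y}]])).
    by move=> s /=; rewrite inE andbT.
  by apply: h => a a'; rewrite !inE.
have [q] := ubnP #|A|; elim: q A => // q IH A Aq dA.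
have [->|[a0 a0A]] := set_0Vmem A.
  move=> k km c sc zc; exists (fun=> 0) => [s|s]; first by rewrite eqxx.
  by rewrite /= inE andbF.
have [a aA' amax] := arg_maxnP (fun a => #|pred_of_set a|) a0A.
have aA : a \in A by [].
have dAa : down (A :\ a).
  move=> x y xy; rewrite !inE => /andP[ya yA]; rewrite (dA _ _ xy yA) andbT.
  apply: contra ya => /eqP xa; rewrite xa in xy.
  by rewrite eq_sym eqEcard xy; apply: amax.
have cFA : convex_family [pred s | F s & g s \in A].
  move=> s t u st tu /= /andP[Fs _] /andP[Fu uA].
  by rewrite (cF _ _ _ st tu) //= (dA _ _ (mg _ _ tu)).
pose X := [pred s | g s \in A :\ a].
have dX : down_in [pred s | F s & g s \in A] X.
  by move=> s t st _ _ /=; apply: dAa; apply: mg.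
apply: (acyclic_below_ext cFA dX).
  apply: (eq_acyclic_below (F := [pred s | F s & g s \in A :\ a])).
    by move=> s /=; rewrite !inE; case: (F s); case: (_ == _); case: (_ \in _).
  by apply: IH => //; move: Aq; rewrite (cardsD1 a) aA.
apply: (eq_acyclic_below (F := [pred s | F s & g s == a])).
  move=> s /=; rewrite !inE; case: (eqVneq (g s) a) => [->|_] /=.
    by rewrite aA !andbT.
  by case: (F s); case: (_ \in _).
exact: aF.
Qed.

(** A cone whose apex varies with the face. The apex depends only on the vertices satisfying [P] and
    is not one of them, so toggling it stays within a fibre of the filtration by these vertices. *)
Lemma acyclic_below_toggle F (P : pred W) (apex : {set W} -> W) m :
  convex_family F ->
  (forall s, F s -> let w := apex [set u in s | P u] in
     [/\ ~~ P w, F (w |: s) & F (s :\ w)]) -> acyclic_below F m.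
Proof.
move=> cF h; apply: (@acyclic_below_filter _ _ (fun s => [set u in s | P u])) => //.
  by move=> s t st; apply/subsetP => u; rewrite !inE => /andP[/(subsetP st)-> ->].
move=> a k _; set w := apex a.
have lowU s : ~~ P w -> [set u in w |: s | P u] = [set u in s | P u].
  move=> nP; apply/setP => u; rewrite !inE.
  by case: (eqVneq u w) => // ->; rewrite (negbTE nP) !andbF.
have lowD s : ~~ P w -> [set u in s :\ w | P u] = [set u in s | P u].
  move=> nP; apply/setP => u; rewrite !inE.
  by case: (eqVneq u w) => // ->; rewrite (negbTE nP) !andbF.
have [Pw|nPw] := boolP (P w).
  move=> c sc _; exists (fun=> 0) => [s|s /= /andP[Fs /eqP sa]].
    by rewrite eqxx.
  by have := h s Fs; rewrite sa => -[]; rewrite Pw.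
apply: (acyclic_cone (w := w)) => s /=; rewrite lowU // lowD //.
case: eqP => [sa|]; last by rewrite !andbF.
rewrite !andbT; apply/idP/idP => /h; rewrite ?lowU ?lowD // sa -/w => -[_].
  rewrite (_ : (w |: s) :\ w = s :\ w) //.
  by apply/setP => u; rewrite !inE; case: eqVneq.
rewrite (_ : w |: (s :\ w) = w |: s) //.
by apply/setP => u; rewrite !inE; case: eqVneq.
Qed.

End Acyclicity.

(** * Chains of sets *)

Section SetPosets.
Variables (W V : finType) (phi : W -> {set V}) (psi : {set V} -> W).
Hypothesis psiK : cancel psi phi.
Implicit Types (s t : {set W}) (sigma tau rho : {set V}) (Q M : pred {set V}).

Definition chain s :=
  [forall u in s, forall v in s, (phi u \subset phi v) || (phi v \subset phi u)].
(* The largest member of a chain s (and set0 for the empty chain). *)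
Definition cup s := \bigcup_(u in s) phi u.
Definition all_in Q s := [forall u in s, Q (phi u)].
(** For [M = pred1 rho] these are the chains with largest member [rho]. The empty chain belongs to
    them exactly when [M set0] holds. *)
Definition chains Q M : pred {set W} := fun s => [&& chain s, all_in Q s & M (cup s)].
Definition convex_on M := forall sigma1 sigma2 sigma3 : {set V},
  sigma1 \subset sigma2 -> sigma2 \subset sigma3 -> M sigma1 -> M sigma3 -> M sigma2.
Definition upset Q := forall sigma tau, sigma \subset tau -> Q sigma -> Q tau.

Lemma chainP s :
  reflect {in s &, forall u v, (phi u \subset phi v) || (phi v \subset phi u)} (chain s).
Proof.
apply: (iffP forall_inP) => [h u v us vs|h u us]; last by apply/forall_inP => v; apply: h.
by have /forall_inP := h u us; apply.
Qed.

Lemma all_inP Q s : reflect {in s, forall u, Q (phi u)} (all_in Q s).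
Proof. exact: forall_inP. Qed.

Lemma all_inPn Q s : reflect (exists2 u, u \in s & ~~ Q (phi u)) (~~ all_in Q s).
Proof. exact: forall_inPn. Qed.

Lemma chain_down s t : s \subset t -> chain t -> chain s.
Proof. by move=> /subsetP st /chainP h; apply/chainP => u v /st ut /st; apply: h. Qed.

Lemma all_in_down Q s t : s \subset t -> all_in Q t -> all_in Q s.
Proof. by move=> /subsetP st /all_inP h; apply/all_inP => u /st; apply: h. Qed.

Lemma cup_mono s t : s \subset t -> cup s \subset cup t.
Proof.
move=> /subsetP st; apply/bigcupsP => u /st ut.
by apply: (bigcup_max u).
Qed.

Lemma sub_cup u s : u \in s -> phi u \subset cup s.
Proof. by move=> us; apply: (bigcup_max u). Qed.

Lemma cup_setU1 u s : cup (u |: s) = phi u :|: cup s.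
Proof.
apply/eqP; rewrite eqEsubset subUset sub_cup ?setU11 //= cup_mono ?subsetUr // andbT.
apply/bigcupsP => w; rewrite !inE => /predU1P[->|/sub_cup h]; first exact: subsetUl.
exact: subset_trans h (subsetUr _ _).
Qed.

Lemma chains_convex Q M :
  convex_on M ->
  convex_family (chains Q M).
Proof.
move=> cM r s t rs st /and3P[_ _ Mr] /and3P[ct it Mt].
rewrite /chains (chain_down st) // (all_in_down st) //=.
exact: cM (cup_mono rs) (cup_mono st) _ _.
Qed.

Lemma all_in_down_in Q F : down_in F (all_in Q).
Proof. by move=> s t st _ _; apply: all_in_down. Qed.

Lemma chain_setU1 u s : chain s ->
  {in s, forall v, (phi u \subset phi v) || (phi v \subset phi u)} -> chain (u |: s).
Proof.
move=> /chainP cs h; apply/chainP => v w; rewrite !inE.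
case/predU1P => [->|vs] /predU1P[->|ws]; rewrite ?subxx //; try exact: h.
- by rewrite orbC; apply: h.
- exact: cs.
Qed.

(** In a chain the members not containing [T] lie below those containing it; the union of the former
    with [T] fits in between and can be toggled. [M] does not notice this, as it ignores [T]. *)
Lemma acyclic_below_join Q M (X : pred {set W}) (T : {set V}) m :
  convex_family [pred s | chains Q M s & X s] ->
  (forall sigma, M (sigma :|: T) = M sigma) ->
  (forall s, chains Q M s -> X s ->
     let w := psi (cup [set u in s | ~~ (T \subset phi u)] :|: T) in
     [/\ Q (phi w), X (w |: s) & X (s :\ w)]) ->
  acyclic_below [pred s | chains Q M s & X s] m.
Proof.
move=> cF MT h.
pose P u := ~~ (T \subset phi u).
pose apex a := psi (cup a :|: T).
apply: (acyclic_below_toggle (P := P) (apex := apex)) => // s /andP[Fs Xs] w.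
have {h} [Qw XU XD] := h s Fs Xs; rewrite -/(apex _) -/w in Qw XU XD.
have /and3P[cs qs Ms] := Fs.
set a := [set u in s | P u] in w Qw XU XD *.
have phiw : phi w = cup a :|: T by rewrite psiK.
have nPw : ~~ P w by rewrite negbK phiw subsetUr.
have ain : a \subset s by apply/subsetP => u; rewrite inE => /andP[].
split=> //=.
  rewrite XU andbT; apply/and3P; split.
  - apply: chain_setU1 => // u us; have [uT|uT] := boolP (T \subset phi u).
      apply/orP; left; rewrite phiw subUset uT andbT.
      apply/bigcupsP => v; rewrite inE => /andP[vs vT].
      have /orP[//|uv] := chainP _ cs v u vs us.
      by rewrite /P (subset_trans uT uv) in vT.
    apply/orP; right; rewrite phiw; apply: subset_trans (subsetUl _ _).
    by apply: sub_cup; rewrite inE us.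
  - by apply/all_inP => u; rewrite !inE => /predU1P[->//|]; apply: (all_inP _ _ qs).
  - rewrite cup_setU1 phiw setUAC -MT -setUA setUid MT -/(is_true _).
    by rewrite (setUidPr (cup_mono ain)).
rewrite XD andbT /chains (chain_down (subsetDl _ _) cs).
rewrite (all_in_down (subsetDl _ _) qs) /= -MT.
suff -> : cup (s :\ w) :|: T = cup s :|: T by rewrite MT.
apply/eqP; rewrite eqEsubset setSU ?cup_mono ?subsetDl //= subUset subsetUr andbT.
apply/bigcupsP => u us; have [->|uw] := eqVneq u w.
  rewrite phiw setSU // cup_mono // subsetD1 ain /= inE negb_and.
  by rewrite nPw orbT.
by apply: subset_trans (subsetUl _ _); apply: sub_cup; rewrite !inE uw.
Qed.

Lemma acyclic_below_join_all Q M (T : {set V}) m :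
  convex_on M ->
  upset Q -> Q T -> (forall sigma, M (sigma :|: T) = M sigma) ->
  acyclic_below (chains Q M) m.
Proof.
move=> cM uQ QT MT.
apply: (eq_acyclic_below (F := [pred s | chains Q M s & true])).
  by move=> s /=; rewrite andbT.
apply: (@acyclic_below_join Q M (fun=> true) T) => //.
  move=> r s t rs st /= /andP[Fr _] /andP[Ft _].
  by rewrite (chains_convex cM rs st).
by move=> s Fs _ w; split=> //; rewrite psiK; apply: uQ QT; apply: subsetUr.
Qed.

Lemma convex_pred1 rho : convex_on (pred1 rho).
Proof.
move=> sigma1 sigma2 sigma3 s12 s23 /eqP e1 /eqP e3.
by rewrite /= eqEsubset -{1}e3 -e1 s12 s23.
Qed.

Lemma convex_setU1 v rho : convex_on [pred sigma | v |: sigma == v |: rho].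
Proof.
move=> sigma1 sigma2 sigma3 s12 s23 /= /eqP e1 /eqP e3.
by rewrite eqEsubset -{1}e3 -e1 !setUS.
Qed.

(** A member outside [Q1] avoids [v], whereas the toggled set contains [v] and this member, hence
    satisfies [Q1]. Toggling thus never touches the offending member, and the bound [m] is
    arbitrary. *)
Lemma acyclic_below_link Q Q1 rho v m :
  upset Q -> upset Q1 -> (forall sigma, Q sigma -> Q1 (v |: sigma)) ->
  acyclic_below
    [pred s | chains Q [pred sigma | v |: sigma == v |: rho] s & ~~ all_in Q1 s] m.
Proof.
move=> uQ uQ1 QQ1.
apply: (@acyclic_below_join Q _ (fun s => ~~ all_in Q1 s) [set v]).
- exact: convex_quot (chains_convex (@convex_setU1 v rho)) (@all_in_down_in _ _).
- by move=> sigma /=; rewrite setUCA setUid [X in X == _]setUC.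
move=> s Fs /all_inPn[u us nQ1u] w.
have /and3P[cs qs _] := Fs.
have Qu := all_inP _ _ qs u us.
have vu : v \notin phi u.
  apply: contra nQ1u => vu; have := QQ1 _ Qu.
  by rewrite (setUidPr _) // sub1set.
have uw : phi u \subset phi w.
  rewrite psiK; apply: subset_trans (subsetUl _ _); apply: sub_cup.
  by rewrite inE us sub1set.
have Q1w : Q1 (phi w).
  apply: uQ1 (QQ1 _ Qu); rewrite subUset uw psiK andbT.
  exact: subsetUr.
split; first exact: uQ uw Qu.
  by apply/all_inPn; exists u => //; rewrite !inE us orbT.
apply/all_inPn; exists u => //; rewrite !inE us andbT.
by apply: contra nQ1u => /eqP->.
Qed.

(** Delete [v] from the smallest member containing it and toggle the resulting set; such a member
    exists because [v] lies in the top [rho]. *)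
Lemma acyclic_below_top Q rho v m :
  v \in rho -> upset Q -> (forall sigma, Q (v |: sigma) -> Q sigma) ->
  acyclic_below (chains Q (pred1 rho)) m.
Proof.
move=> vrho uQ Qv.
pose P u := v \in phi u.
pose apex (b : {set W}) := psi ((\bigcap_(u in b) phi u) :\ v).
apply: (acyclic_below_toggle (P := P) (apex := apex)).
  exact: chains_convex (@convex_pred1 rho).
move=> s /and3P[cs qs /eqP sE] w.
set b := [set u in s | P u] in w *.
have phiw : phi w = (\bigcap_(u in b) phi u) :\ v by rewrite psiK.
have nPw : ~~ P w by rewrite /P phiw !inE eqxx.
have wb u : u \in b -> phi w \subset phi u.
  by move=> ub; rewrite phiw; apply: subset_trans (subsetDl _ _) _; apply: bigcap_inf.
have [u0 u0b u0min] : exists2 u0, u0 \in b & forall u, u \in b -> phi u0 \subset phi u.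
  have /bigcupP[u us vu] : v \in cup s by rewrite sE.
  have ub : u \in b by rewrite inE us.
  have [u0 u0b' h] := arg_minnP (fun u => #|phi u|) ub.
  have u0b : u0 \in b by [].
  exists u0 => // x xb; move: (u0b) (xb); rewrite !inE => /andP[u0s _] /andP[xs _].
  have /orP[//|xu] := chainP _ cs u0 x u0s xs.
  by have /eqP-> : phi x == phi u0; rewrite // eqEcard xu; apply: h.
have Qw : Q (phi w).
  apply: Qv; apply: uQ (all_inP _ _ qs u0 _); last by move: u0b; rewrite inE => /andP[].
  apply/subsetP => x xu; rewrite phiw !inE; case: eqVneq => //= _.
  by apply/bigcapP => u ub; apply: subsetP (u0min u ub) x xu.
have wcup : phi w \subset cup s.
  apply: subset_trans (wb _ u0b) _; apply: sub_cup.
  by move: u0b; rewrite inE => /andP[].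
split=> //.
  apply/and3P; split; last by rewrite /= cup_setU1 (setUidPr wcup) sE.
    apply: chain_setU1 => // u us; have [vu|vu] := boolP (v \in phi u).
      by rewrite wb // inE us.
    apply/orP; right; rewrite phiw subsetD1 vu andbT.
    apply/bigcapsP => x; rewrite inE => /andP[xs vx].
    have /orP[//|xu] := chainP _ cs u x us xs.
    by rewrite (subsetP xu) in vu.
  by apply/all_inP => u; rewrite !inE => /predU1P[->//|]; apply: (all_inP _ _ qs).
rewrite /chains (chain_down (subsetDl _ _) cs) (all_in_down (subsetDl _ _) qs) /=.
rewrite eqEsubset -{1}sE cup_mono ?subsetDl //= -sE.
apply/bigcupsP => u us; have [->|uw] := eqVneq u w; last by apply: sub_cup; rewrite !inE uw.
apply: subset_trans (wb _ u0b) _; apply: sub_cup; move: (u0b); rewrite !inE => /andP[-> Pu0].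
by rewrite andbT; apply: contra nPw => /eqP<-.
Qed.

Lemma down_in_cup (F : pred {set W}) v rho : v \notin rho ->
  (forall s, F s -> v |: cup s = v |: rho) ->
  down_in F [pred s | cup s == rho].
Proof.
move=> vrho h s t st Fs _ /= /eqP tE; rewrite eqEsubset -{1}tE cup_mono //=.
apply/subsetP => u urho; have : u \in v |: cup s by rewrite h // !inE urho orbT.
by rewrite !inE => /predU1P[uv|//]; rewrite uv (negbTE vrho) in urho.
Qed.

Lemma setU1_eq_cases v rho sigma : v \notin rho ->
  (v |: sigma == v |: rho) = (sigma == rho) || (sigma == v |: rho).
Proof.
move=> vrho; apply/idP/idP => [/eqP h|/orP[]/eqP->//]; last by rewrite setUA setUid.
have [vs|vs] := boolP (v \in sigma).
  by apply/orP; right; rewrite -h (setUidPr _) // sub1set.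
by apply/orP; left; rewrite -(setU1K vs) h setU1K.
Qed.

Lemma setU1_neq v rho : v \notin rho -> (v |: rho == rho) = false.
Proof. by move=> h; apply: contraNF h => /eqP<-; rewrite setU11. Qed.

(** Chains with top [rho] or [v |: rho] form an acyclic complex, by joining [v]. Those with top
    [rho] are a subcomplex, and the quotient gains one degree. *)
Lemma acyclic_below_setU1_vertex Q rho v m :
  v \notin rho -> upset Q -> Q [set v] ->
  acyclic_below (chains Q (pred1 rho)) m ->
  acyclic_below (chains Q (pred1 (v |: rho))) m.+1.
Proof.
move=> vrho uQ Qv am.
pose M := [pred sigma | v |: sigma == v |: rho].
have cM : convex_on M by apply: convex_setU1.
have aE : acyclic_below (chains Q M) m.+1.
  by apply: (@acyclic_below_join_all _ _ [set v]) => // sigma /=; rewrite setUCA setUid [X in X == _]setUC.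
have dX : down_in (chains Q M) [pred s | cup s == rho].
  by apply: (down_in_cup vrho) => s /and3P[_ _ /eqP].
have := acyclic_below_quot (chains_convex cM) dX aE.
move=> h; apply: eq_acyclic_below (h _) => [s|].
  rewrite /= /chains /= -!andbA setU1_eq_cases //.
  by case: eqVneq => [->|] /=; rewrite ?andbT // eq_sym setU1_neq.
apply: eq_acyclic_below am => s; rewrite /= /chains /= -!andbA setU1_eq_cases //.
by case: eqVneq; rewrite /= ?andbF.
Qed.

(** In the application, [Q], [Qp] and [Q0] mean capturing a subspace, its sum with the ray of a
    vector outside it, and its sum with the line of that vector, which is indexed by [v]. *)
Lemma acyclic_below_setU1 Q Qp Q0 rho v m :
  v \notin rho -> upset Q -> upset Qp -> upset Q0 ->
  (forall sigma, v \notin sigma -> Q0 sigma = Qp sigma || Q (v |: sigma)) ->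
  (forall sigma, v \notin sigma -> Q sigma = Qp sigma && Q (v |: sigma)) ->
  acyclic_below (chains Q (pred1 rho)) m ->
  acyclic_below (chains Q0 (pred1 rho)) m.+1 ->
  acyclic_below (chains Q (pred1 (v |: rho))) m.+1.
Proof.
move=> vrho uQ uQp uQ0 Q0E QE aQ aQ0.
pose Qm := [pred sigma | Q (v |: sigma)].
have uQm : upset Qm by move=> s t st /=; apply: uQ; apply: setUS.
have vs s u : cup s = rho -> u \in s -> v \notin phi u.
  by move=> sE us; apply: contra vrho => vu; rewrite -sE; apply: (subsetP (sub_cup us)).
(* For chains with top rho, [Q = Qp /\ Qm] and [Q0 = Qp \/ Qm], so that Q0
   modulo Qp equals Qm modulo Q; adjoining v on top of the chains moves this
   quotient to top v |: rho one degree higher. *)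
have aQp : acyclic_below [pred s | chains Q0 (pred1 rho) s & all_in Qp s] m.
  apply: (acyclic_below_Mayer_Vietoris (B := all_in Qm)).
  - exact: chains_convex (@convex_pred1 rho).
  - exact: all_in_down_in.
  - exact: all_in_down_in.
  (* If one member fails [Qp] and another fails [Qm], the smaller of the two satisfies [Qp] or [Qm],
     and passing this up to the larger gives a contradiction. *)
  - move=> s /and3P[cs qs /eqP sE]; apply: contraT; rewrite negb_or.
    case/andP => /all_inPn[u us nu] /all_inPn[x xs nx].
    have := all_inP _ _ qs; have /orP[ux|xu] := chainP _ cs u x us xs => h.
      have := h u us; rewrite Q0E ?(vs s) // (negbTE nu) /= => Qu.
      by case/negP: nx; apply: uQm ux Qu.
    have := h x xs; rewrite Q0E ?(vs s) // -[Q _]/(Qm (phi x)) (negbTE nx) orbF => Qx.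
    by case/negP: nu; apply: uQp xu Qx.
  - exact: acyclic_below_le aQ0.
  apply: eq_acyclic_below aQ => s; apply/idP/idP.
    move=> /and3P[cs /all_inP qs /eqP sE]; rewrite /= /chains cs /= sE eqxx andbT.
    apply/and3P; split; apply/all_inP => u us; 
     have vu := vs s u sE us; have := qs u us; rewrite (QE _ vu) => /andP[h1 h2];
     rewrite ?Q0E ?h1 //.
  case/and3P => /and3P[cs _ /eqP sE] /all_inP h1 /all_inP h2.
  rewrite /chains cs /= sE eqxx andbT; apply/all_inP => u us.
  by rewrite QE ?(vs s) // h1 //; apply: h2.
have aS' := acyclic_below_quot (chains_convex (@convex_pred1 rho)) (@all_in_down_in Qp _) aQ0 aQp.
pose M := [pred sigma | v |: sigma == v |: rho].
pose S := [pred s | chains Qm M s & ~~ all_in Q s].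
have cM : convex_on M by apply: convex_setU1.
have cS : convex_family S := convex_quot (chains_convex cM) (@all_in_down_in Q _).
have dX : down_in S [pred s | cup s == rho].
  by apply: (down_in_cup vrho) => s /andP[/and3P[_ _ /eqP]].
have aS : acyclic_below S m.+2 by apply: acyclic_below_link.
have {}aS : acyclic_below [pred s | chains Qm (pred1 (v |: rho)) s & ~~ all_in Q s] m.+2.
  have := acyclic_below_quot cS dX aS.
  move=> h; apply: eq_acyclic_below (h _) => [s|].
    rewrite /= /chains /= -!andbA setU1_eq_cases //.
    case: eqVneq => [->|] /=; last by rewrite andbT.
    by rewrite eq_sym setU1_neq //= !andbF.
  apply: eq_acyclic_below aS' => s; apply/idP/idP.
    case/andP => /and3P[cs qs /eqP sE] /all_inPn[u us nu].
    rewrite /= /chains cs /= sE !eqxx /= andbT.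
    have Qmu : Qm (phi u).
      by have := all_inP _ _ qs u us; rewrite Q0E ?(vs s) // (negbTE nu).
    apply/andP; split.
      rewrite andbT; apply/all_inP => x xs.
      have /orP[ux|xu] := chainP _ cs u x us xs; first exact: uQm ux Qmu.
      have := all_inP _ _ qs x xs; rewrite Q0E ?(vs s) // => /orP[Qx|//].
      by case/negP: nu; apply: uQp xu Qx.
    by apply/all_inPn; exists u; rewrite // QE ?(vs s) // (negbTE nu).
  case/andP => /andP[/and3P[cs qs _] /all_inPn[u us nu]] /eqP sE.
  rewrite /= /chains cs /= sE eqxx andbT; apply/andP; split.
    by apply/all_inP => x xs; rewrite Q0E ?(vs s) // [Q _](all_inP _ _ qs x xs) orbT.
  apply/all_inPn; exists u => //; apply: contra nu => Qpu.
  by rewrite QE ?(vs s) // Qpu; apply: (all_inP _ _ qs).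
(* [Qm] ignores [v], so the chains of [Qm] with top [v |: rho] have no homology; passing to those in
   [Q] lowers the bound [m.+2] by one. *)
have aT : acyclic_below (chains Qm (pred1 (v |: rho))) m.+1.
  apply: (@acyclic_below_top _ _ v) => //; first exact: setU11.
  by move=> sigma /=; rewrite setUA setUid.
have := acyclic_below_sub (chains_convex (@convex_pred1 (v |: rho))) (@all_in_down_in Q _) aT aS.
apply: eq_acyclic_below => s; rewrite /= /chains.
case: (chain s) => //=; rewrite andbAC.
case: (_ == _); rewrite ?andbF //= !andbT.
case: (boolP (all_in Q s)); rewrite ?andbF // andbT => /all_inP h.
by apply/all_inP => u us /=; apply: uQ (h u us); apply: subsetUr.
Qed.

End SetPosets.

(** * Rainbow sets *)

Section Colours.
Variables (W V : finType) (phi : W -> {set V}) (psi : {set V} -> W).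
Hypotheses (psiK : cancel psi phi).
Variables (n N : nat) (colour : V -> 'I_n) (Q : pred {set V}).
Let colour_class k := [set x | colour x == k].
Hypotheses (uQ : upset Q) (Qclass : forall k, Q (colour_class k)).
Hypothesis sphere : forall rho, acyclic_below (chains phi Q (pred1 rho)) (#|rho| - N).
Let low k := [set x | (colour x < k)%N].

(** Interpolates between [pred1 rho] at [k = n] and [rainbow] at [k = 0] with [rho] empty; the
    variant [partial_rainbow_full] lifts the restriction on colour [k]. *)
Let partial_rainbow k (rho : {set V}) : pred {set V} := fun sigma =>
  (sigma :&: low k == rho) &&
  [forall i : 'I_n, (k <= i)%N ==> (#|sigma :&: colour_class i| <= 1)%N].

Let partial_rainbow_full k (rho : {set V}) : pred {set V} := fun sigma =>
  (sigma :&: low k == rho) &&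
  [forall i : 'I_n, (k < i)%N ==> (#|sigma :&: colour_class i| <= 1)%N].

Let convex_full k rho : convex_on (partial_rainbow_full k rho).
Proof.
move=> sigma1 sigma2 sigma3 s12 s23 /andP[/eqP e1 _] /andP[/eqP e3 /forallP h].
apply/andP; split; first by rewrite eqEsubset -{1}e3 -e1 !setSI.
apply/forallP => i; apply/implyP => ki; apply: leq_trans (implyP (h i) ki).
by rewrite subset_leq_card // setSI.
Qed.

(** Induction on the number [q] of colours whose trace is not prescribed; each contributes one to
    the bound, as does each element of [rho]. *)
Lemma acyclic_below_partial_rainbow q k (rho : {set V}) : (k + q)%N = n -> rho \subset low k ->
  acyclic_below (chains phi Q (partial_rainbow k rho)) (#|rho| + q - N).
Proof.
elim: q k rho => [|q IH] k rho kq rhok.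
  have kn (i : 'I_n) : (i < k)%N by rewrite addn0 in kq; rewrite kq.
  rewrite addn0; apply: eq_acyclic_below (sphere (rho := rho)) => s.
  rewrite /chains; congr [&& _, _ & _]; rewrite /partial_rainbow.
  have -> : low k = setT by apply/setP => x; rewrite !inE kn.
  rewrite setIT; apply/idP/andP => [e|[]//]; split=> //.
  by apply/forallP => i; rewrite leqNgt kn.
have kn : (k < n)%N by lia.
pose K := Ordinal kn.
pose X := [pred s : {set W} | #|cup phi s :&: colour_class K| <= 1]%N.
set m := (_ - N)%N.
have [->//|m0] := posnP m.
have cF := chains_convex (phi := phi) (Q := Q) (@convex_full k rho).
have dX : down_in (chains phi Q (partial_rainbow_full k rho)) X.
  move=> s t st _ _ /=; apply: leq_trans.
  by rewrite subset_leq_card // setSI // cup_mono.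
have KE (i : 'I_n) : (k <= i)%N = (i == K) || (k < i)%N.
  by rewrite leq_eqVlt eq_sym.
have lowS : low k.+1 = low k :|: colour_class K.
  apply/setP => x; rewrite !inE ltnS leq_eqVlt orbC; congr orb.
have dis : low k :&: colour_class K = set0.
  apply/setP => x; rewrite !inE; apply/negbTE; apply/negP => /andP[h /eqP e].
  by rewrite e ltnn in h.
apply: (eq_acyclic_below
  (F := [pred s | chains phi Q (partial_rainbow_full k rho) s & X s])).
  move=> s; rewrite /= /chains -!andbA; congr [&& _, _ & _].
  rewrite /partial_rainbow /partial_rainbow_full -?andbA; congr (_ && _).
  apply/andP/forallP => [[/forallP h Xs] i|h].
    apply/implyP; rewrite KE => /orP[/eqP->//|]; exact: (implyP (h i)).
  split; last by apply: (implyP (h K)).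
  by apply/forallP => i; apply/implyP => ki; apply: (implyP (h i)); apply: ltnW.
apply: (acyclic_below_sub cF dX).
  apply: (acyclic_below_join_all psiK (@convex_full k rho) uQ (Qclass K)) => sigma.
  rewrite /partial_rainbow_full setIUl (setIC (colour_class K) (low k)) dis setU0; congr (_ && _).
  apply: eq_forallb => i; case: (ltnP k i) => //= ki.
  rewrite setIUl (_ : colour_class K :&: colour_class i = set0) ?setU0 //.
  apply/setP => x; rewrite !inE; apply/negbTE/negP => /andP[/eqP-> /eqP e].
  by rewrite -e ltnn in ki.
apply: (acyclic_below_filter (g := fun s => cup phi s :&: colour_class K)).
- exact: convex_quot.
- by move=> s t st; rewrite setSI // cup_mono.
(* A trace [a] with at least two elements joins [rho]: one colour is traded for [#|a|] elements,
   which gains the extra degree. For any other [a] the fibre is empty. *)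
move=> a; have [/andP[aK a2]|na] := boolP ((a \subset colour_class K) && (1 < #|a|)%N).
  have disj : rho :&: a = set0.
    by apply/eqP; rewrite -subset0 -dis setISS.
  have lowa : rho :|: a \subset low k.+1 by rewrite lowS setUSS.
  have h := IH k.+1 (rho :|: a) _ lowa.
  apply: eq_acyclic_below (acyclic_below_le _ (h _)); [|rewrite cardsU disj cards0; lia|lia].
  move=> s; rewrite /= /chains; case: (chain phi s) => //=; case: all_in => //=.
  rewrite /partial_rainbow /partial_rainbow_full lowS setIUr.
  have -> : (cup phi s :&: low k :|: cup phi s :&: colour_class K == rho :|: a) =
     (cup phi s :&: low k == rho) && (cup phi s :&: colour_class K == a).
    apply/eqP/andP => [e|[/eqP-> /eqP->]//].
    have e1 : (cup phi s :&: low k :|: cup phi s :&: colour_class K) :&: low k = cup phi s :&: low k.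
      rewrite setIUl -!setIA setIid (setIC (colour_class K)) dis setI0 setU0 //.
    have e2 : (cup phi s :&: low k :|: cup phi s :&: colour_class K) :&: colour_class K
        = cup phi s :&: colour_class K.
      by rewrite setIUl -!setIA setIid dis setI0 set0U.
    have a0 : a :&: low k = set0.
      by apply/eqP; rewrite -subset0 -dis setIC setIS.
    have r0 : rho :&: colour_class K = set0.
      by apply/eqP; rewrite -subset0 -dis setSI.
    split; apply/eqP; first by rewrite -e1 e setIUl (setIidPl rhok) a0 setU0.
    by rewrite -e2 e setIUl (setIidPl aK) r0 set0U.
  case: (eqVneq (cup phi s :&: colour_class K) a) => [->|_] /=; last by rewrite !andbF.
  by rewrite -ltnNge a2 !andbT.
apply: (eq_acyclic_below (F := pred0)) => [s|p _ c sc _]; last first.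
  by exists (fun=> 0) => // s; rewrite eqxx.
apply/esym/negbTE; apply: contra na => /= /andP[/andP[_ h] /eqP e].
by rewrite -e subsetIr ltnNge.
Qed.

Definition rainbow : pred {set V} :=
  fun sigma => [forall i, (#|sigma :&: colour_class i| <= 1)%N].

Lemma acyclic_below_rainbow : acyclic_below (chains phi Q rainbow) (n - N).
Proof.
have low0 : low 0 = set0 by apply/setP => x; rewrite !inE.
have h := acyclic_below_partial_rainbow (add0n n) (sub0set (low 0)).
rewrite cards0 add0n in h.
apply: eq_acyclic_below h => s; rewrite /chains; congr [&& _, _ & _].
by rewrite /partial_rainbow low0 setI0 eqxx.
Qed.

End Colours.

(** * Sets of vectors capturing a subspace *)

Section Capture.
Variables (R : realFieldType) (E : vectType R) (V : finType) (f : V -> E).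
Implicit Types (L : {vspace E}) (sigma rho : {set V}).

(** Equivalently, the images in the quotient of [E] by [L] have a nontrivial nonnegative dependence
    supported on [sigma]; varying [L] avoids quotient spaces. The positive sum excludes the zero
    combination. *)
Definition captures L sigma := exists lam : V -> R,
  [/\ forall v, 0 <= lam v, forall v, v \notin sigma -> lam v = 0,
      0 < \sum_v lam v & \sum_v lam v *: f v \in L].

(* [captures L] with L replaced by the cone L + R_+ (f v). *)
Definition captures_ray L v sigma := exists lam : V -> R, exists2 t, 0 <= t &
  [/\ forall v, 0 <= lam v, forall v, v \notin sigma -> lam v = 0,
      0 < \sum_v lam v & \sum_v lam v *: f v - t *: f v \in L].

Lemma captures_upset L : upset (fun sigma => `[< captures L sigma >]).
Proof.
move=> s t /subsetP st /asboolP[lam [l0 ls lp lL]]; apply/asboolP; exists lam.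
by split=> // v vt; apply: ls; apply: contra vt; apply: st.
Qed.

Lemma captures_ray_upset L v : upset (fun sigma => `[< captures_ray L v sigma >]).
Proof.
move=> s t /subsetP st /asboolP[lam [x x0 [l0 ls lp lL]]]; apply/asboolP; exists lam, x => //.
by split=> // w wt; apply: ls; apply: contra wt; apply: st.
Qed.

Lemma captures_set1 L v : f v \in L -> captures L [set v].
Proof.
move=> fL; exists (fun w => (w == v)%:R); split.
- by move=> w; rewrite ler0n.
- by move=> w; rewrite inE => /negbTE->.
- by rewrite (bigD1 v) //= eqxx big1 ?addr0 // => w /negbTE->.
rewrite (bigD1 v) //= eqxx scale1r big1 ?addr0 // => w /negbTE->.
by rewrite scale0r.
Qed.

Lemma sum_add_at (lam : V -> R) c v :
  \sum_w (lam w + c * (w == v)%:R) = \sum_w lam w + c.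
Proof.
rewrite big_split /=; congr (_ + _).
by rewrite (bigD1 v) //= eqxx mulr1 big1 ?addr0 // => w /negbTE->; rewrite mulr0.
Qed.

Lemma sum_scale_add_at (lam : V -> R) c v :
  \sum_w (lam w + c * (w == v)%:R) *: f w = \sum_w lam w *: f w + c *: f v.
Proof.
under eq_bigr do rewrite scalerDl.
rewrite big_split /=; congr (_ + _).
rewrite (bigD1 v) //= eqxx mulr1 big1 ?addr0 // => w /negbTE->.
by rewrite mulr0 scale0r.
Qed.

(** The coefficient of [v] is split off. What remains is nonzero, since otherwise a positive
    multiple of [f v] would lie in [L]. *)
Lemma captures_setU1_split L v sigma : v \notin sigma -> f v \notin L ->
  captures L (v |: sigma) -> exists lam : V -> R, exists2 t, 0 <= t &
  [/\ forall v, 0 <= lam v, forall v, v \notin sigma -> lam v = 0,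
      0 < \sum_v lam v & \sum_v lam v *: f v + t *: f v \in L].
Proof.
move=> vs fL [lam [l0 ls lp lL]].
pose lam' w := lam w + - lam v * (w == v)%:R.
have lamv : lam' v = 0 by rewrite /lam' eqxx mulr1 subrr.
have lamE w : w != v -> lam' w = lam w by move=> /negbTE wv; rewrite /lam' wv mulr0 addr0.
have l'0 w : 0 <= lam' w by have [->|/lamE->//] := eqVneq w v; rewrite lamv.
exists lam', (lam v) => //; split=> //.
- move=> w ws; have [->//|wv] := eqVneq w v.
  by rewrite lamE // ls // !inE (negbTE wv).
- rewrite lt_def sumr_ge0 // andbT; apply: contra fL => /eqP s0.
  have z w : lam' w = 0.
    apply/eqP; move/eqP: s0; rewrite psumr_eq0 // => /allP/(_ w).
    by rewrite mem_index_enum => /(_ isT).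
  have : \sum_w lam w - lam v = 0 by rewrite -(sum_add_at lam (- lam v) v) big1 // => w _; apply: z.
  move/eqP; rewrite subr_eq0 => /eqP lE; rewrite lE in lp.
  move: lL; rewrite -[X in X \in L](subrK (lam v *: f v)) -scaleNr.
  rewrite -(sum_scale_add_at lam) big1 ?add0r => [|w _]; last by rewrite [X in X *: _]z scale0r.
  by move/(memvZ (lam v)^-1); rewrite scalerA mulVf ?scale1r ?gt_eqF.
by rewrite sum_scale_add_at scaleNr subrK.
Qed.

(** The sign of the coefficient of [f v] decides: if nonnegative, it gives a point of the ray; if
    negative, it moves to the other side as a weight on [v]. *)
Lemma captures_addv L v sigma : v \notin sigma -> f v \notin L ->
  captures (L + <[f v]>)%VS sigma <->
  captures_ray L v sigma \/ captures L (v |: sigma).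
Proof.
move=> vs fL; split.
  move=> [lam [l0 ls lp /memv_addP[u uL [w /vlineP[k ->] SE]]]].
  have [k0|k0] := leP 0 k.
    by left; exists lam, k => //; split=> //; rewrite SE addrK.
  right; exists (fun w => lam w + - k * (w == v)%:R); split.
  - by move=> x; rewrite addr_ge0 // mulr_ge0 ?ler0n // oppr_ge0 ltW.
  - move=> x; rewrite !inE negb_or => /andP[/negbTE-> xs].
    by rewrite mulr0 addr0 ls.
  - by rewrite sum_add_at ltr_wpDr // oppr_ge0 ltW.
  - by rewrite sum_scale_add_at SE scaleNr addrK.
case.
  move=> [lam [t t0 [l0 ls lp lL]]]; exists lam; split=> //.
  by rewrite -(subrK (t *: f v) (\sum_w _)) memv_add // memvZ // memv_line.
case/(captures_setU1_split vs fL) => lam [t t0 [l0 ls lp lL]]; exists lam; split=> //.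
by rewrite -(addrK (t *: f v) (\sum_w _)) memv_add // -scaleNr memvZ // memv_line.
Qed.

(** One combination meets [L] shifted by [t *: f v], the other [L] shifted by [- s *: f v];
    weighting them by [s] and [t] cancels [f v]. *)
Lemma captures_ray_setU1 L v sigma : v \notin sigma -> f v \notin L ->
  captures L sigma <-> captures_ray L v sigma /\ captures L (v |: sigma).
Proof.
move=> vs fL; split.
  move=> [lam [l0 ls lp lL]]; split.
    by exists lam, 0 => //; split=> //; rewrite scale0r subr0.
  exists lam; split=> // w; rewrite !inE negb_or => /andP[_]; exact: ls.
move=> [[lam [t t0 [l0 ls lp lL]]]].
case/(captures_setU1_split vs fL) => mu [s s0 [m0 ms mp mL]].
(* For [t = 0] the weighted sum could vanish, but then [lam] itself serves. *)
move: t0; rewrite le_eqVlt => /predU1P[tE|tp].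
  by exists lam; split=> //; move: lL; rewrite -tE scale0r subr0.
exists (fun w => s * lam w + t * mu w); split.
- by move=> w; rewrite addr_ge0 // mulr_ge0 // ltW.
- by move=> w ws; rewrite ls // ms // !mulr0 addr0.
- by rewrite big_split /= -!mulr_sumr ltr_wpDl ?mulr_gt0 // mulr_ge0 // ltW.
under eq_bigr do rewrite scalerDl -!scalerA.
rewrite big_split /= -!scaler_sumr.
have -> : s *: (\sum_w lam w *: f w) + t *: (\sum_w mu w *: f w) =
   s *: (\sum_w lam w *: f w - t *: f v) + t *: (\sum_w mu w *: f w + s *: f v).
  by rewrite scalerBr scalerDr !scalerA addrACA (mulrC s t) addNr addr0.
by rewrite memvD // memvZ.
Qed.

Lemma dim_addv_line L u : u \notin L -> \dim (L + <[u]>)%VS = (\dim L).+1.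
Proof.
move=> uL; have u0 : u != 0 by apply: contra uL => /eqP->; rewrite mem0v.
rewrite dimv_disjoint_sum ?dim_vline ?u0 ?addn1 //.
apply/eqP; rewrite -subv0; apply/subvP => w; rewrite memv_cap => /andP[wL /vlineP[k wE]].
have [k0|k0] := eqVneq k 0; first by rewrite wE k0 scale0r mem0v.
by case/negP: uL; move/(memvZ k^-1): wL; rewrite wE scalerA mulVf // scale1r.
Qed.

(** * Capturing chains with a fixed largest member *)

Section Sphere.
Variables (W : finType) (phi : W -> {set V}) (psi : {set V} -> W).
Hypotheses (psiK : cancel psi phi).

(** Induction on the size of [rho], for all [L] at once: passing from [L] to [L + <[f v]>] plays the
    role of projecting along [f v]. *)
Lemma acyclic_below_captures L rho :
  acyclic_below (chains phi (fun sigma => `[< captures L sigma >]) (pred1 rho))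
    (#|rho| - (\dim {:E} - \dim L)).
Proof.
have [q] := ubnP #|rho|; elim: q rho L => // q IH rho L rhoq.
have [->|[v vrho]] := set_0Vmem rho; first by rewrite cards0 sub0n.
rewrite -(setD1K vrho); set rho' := rho :\ v.
have vrho' : v \notin rho' by rewrite !inE eqxx.
have cr : #|rho| = #|rho'|.+1 by rewrite (cardsD1 v) vrho.
have r'q : (#|rho'| < q)%N by rewrite cr in rhoq.
rewrite cardsU1 vrho' /= add1n.
have [fL|fL] := boolP (f v \in L).
  apply: (acyclic_below_le (m' := (#|rho'| - (\dim {:E} - \dim L)).+1)); first lia.
  apply: (acyclic_below_setU1_vertex psiK vrho' (@captures_upset L)); last exact: IH.
  by apply/asboolP; apply: captures_set1.
have dL := dim_addv_line fL.
have dE : (\dim (L + <[f v]>)%VS <= \dim {:E})%N by apply: dimvS; apply: subvf.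
set m := (_ - _)%N.
case m0 : m => [//|m'].
apply: (acyclic_below_setU1 psiK vrho' (@captures_upset L) (@captures_ray_upset L v)
  (@captures_upset (L + <[f v]>)%VS)).
- move=> sigma vs; apply/asboolP/orP.
    by move/(captures_addv vs fL) => []; [left|right]; apply/asboolP.
  by move=> h; apply/(captures_addv vs fL); case: h => /asboolP; [left|right].
- move=> sigma vs; apply/asboolP/andP.
    by move/(captures_ray_setU1 vs fL) => []; split; apply/asboolP.
  by move=> [/asboolP h1 /asboolP h2]; apply/(captures_ray_setU1 vs fL).
(* Over [L] the bound drops by one when [v] is removed; over the larger subspace the codimension
   drops as well, which keeps the bound. *)
- by apply: acyclic_below_le (IH _ _ r'q); lia.
- by apply: acyclic_below_le (IH _ _ r'q); lia.
Qed.

End Sphere.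
End Capture.

(** * Tverberg tuples *)

(** As [K] is closed under subsets, boundaries of its chains vanish outside [K], and relative
    acyclicity is the ordinary one. *)
Lemma acyclic_reduced_homology (W : finType) (K : pred {set W}) (j : int) k :
  (forall s t : {set W}, s \subset t -> K t -> K s) -> j + 1 = k%:Z ->
  acyclic K k -> reduced_homology_trivial K j.
Proof.
move=> dK jk aK c cj zc.
have [s c0|t _|b sb e] := aK c; last 1 first.
- exists b; split=> [s /sb[Ks sE]|s]; first by split=> //; rewrite sE jk -addn1 PoszD.
  have [/e//|nK] := boolP (K s).
  have -> : c s = 0 by apply/eqP; apply: contraNT nK => /cj[].
  apply/esym/eqP; apply: contraNT nK => /boundary_neq0[v _ /sb[Kv _]].
  by apply: dK Kv; apply: subsetUr.
- by have [Ks] := cj s c0; rewrite jk => -[].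
- exact: zc.
Qed.

(** * Sarkaria's encoding of Tverberg tuples *)

Section Tverberg.
Variables (R : realType) (d n r : nat) (p : 'I_n -> 'rV[R]_d).
Let V := ('I_n * 'I_r.+1)%type.
Let W := {ffun 'I_r.+1 -> {set 'I_n}}.

(** With the point, the first coordinate, as colour, pairwise disjointness of the parts says that
    the graph is rainbow. *)
Definition graph (Y : W) : {set V} := [set x | x.1 \in Y x.2].
Definition ungraph (sigma : {set V}) : W := [ffun i => [set k | (k, i) \in sigma]].

Lemma ungraphK : cancel ungraph graph.
Proof. by move=> sigma; apply/setP => -[k i]; rewrite inE ffunE inE. Qed.

Lemma tver_le_graph (Y Z : W) : tver_le Y Z = (graph Y \subset graph Z).
Proof.
apply/forallP/subsetP => [h [k i]|h i]; first by rewrite !inE; apply: (subsetP (h i)).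
by apply/subsetP => k ki; have := h (k, i); rewrite !inE; apply.
Qed.

(** Homogeneous coordinates: the last entry records the total weight of a combination. *)
Definition lift_point (k : 'I_n) : 'rV[R]_(d + 1) := row_mx (p k) 1%:M.

(* Sarkaria's tensor trick: [lift_point k] is tensored with the i-th of r + 1
   vectors of R^r whose only linear dependence is that they sum to zero. *)
Definition sarkaria (x : V) : 'M[R]_(r, d + 1) :=
  (\col_j ((x.2 == lift ord0 j)%:R - (x.2 == ord0)%:R)) *m lift_point x.1.

Lemma row_sarkaria (lam : V -> R) j :
  row j (\sum_x lam x *: sarkaria x) =
  \sum_k lam (k, lift ord0 j) *: lift_point k - \sum_k lam (k, ord0) *: lift_point k.
Proof.
rewrite linear_sum -sumrB /=.
transitivity (\sum_k \sum_i row j (lam (k, i) *: sarkaria (k, i))).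
  by rewrite pair_bigA; apply: eq_bigr => -[].
apply: eq_bigr => k _.
have rE i : row j (lam (k, i) *: sarkaria (k, i)) =
    ((i == lift ord0 j)%:R * lam (k, i) - (i == ord0)%:R * lam (k, i)) *: lift_point k.
  rewrite linearZ /= row_mul (_ : row j _ =
    ((i == lift ord0 j)%:R - (i == ord0)%:R)%:M).
    by rewrite mul_scalar_mx scalerA; congr (_ *: _); ring.
  by apply/rowP => z; rewrite !mxE ord1 eqxx mulr1n.
under eq_bigr do rewrite rE.
rewrite -scaler_suml -scalerBl sumrB; congr ((_ - _) *: _).
  rewrite (bigD1 (lift ord0 j)) //= eqxx mul1r big1 ?addr0 // => i /negbTE->.
  by rewrite mul0r.
rewrite (bigD1 ord0) //= mul1r big1 ?addr0 // => i /negbTE->.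
by rewrite mul0r.
Qed.

Lemma sarkaria_sum_eq0 (lam : V -> R) :
  \sum_x lam x *: sarkaria x = 0 <->
  forall i, \sum_k lam (k, i) *: lift_point k = \sum_k lam (k, ord0) *: lift_point k.
Proof.
split=> [e i|e].
  case: (unliftP ord0 i) => [j ->|->//]; apply/eqP; rewrite -subr_eq0.
  by rewrite -row_sarkaria e row0.
by apply/row_matrixP => j; rewrite row_sarkaria e subrr row0.
Qed.

Lemma sum_pairE (lam : V -> R) : \sum_x lam x = \sum_i \sum_k lam (k, i).
Proof. by rewrite exchange_big pair_bigA; apply: eq_bigr => -[]. Qed.

Lemma sum_lift_point (a : 'I_n -> R) :
  \sum_k a k *: lift_point k = row_mx (\sum_k a k *: p k) (\sum_k a k)%:M.
Proof.
rewrite -[LHS]hsubmxK !linear_sum /=; congr row_mx.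
  by apply: eq_bigr => k _; rewrite linearZ /= row_mxKl.
by rewrite raddf_sum /=; apply: eq_bigr => k _; rewrite linearZ /= row_mxKr scalemx1.
Qed.

(** A dependence of the Sarkaria vectors gives all parts the same total weight, which is positive,
    and the same weighted sum of points; their quotient is the common point. Conversely, convex
    weights of a common point form a dependence. *)
Lemma conv_capturesP (Y : W) :
  (exists x, forall i, in_conv p (Y i) x) <-> captures sarkaria 0%VS (graph Y).
Proof.
split.
  case=> x /choice[lam h]; exists (fun v => lam v.2 v.1); split.
  - by move=> [k i]; have [] := h i.
  - by move=> [k i]; rewrite inE /=; have [_ + _ _] := h i; apply.
  - rewrite sum_pairE (eq_bigr (fun=> 1)) => [|i _]; last by have [] := h i.
    by rewrite sumr_const card_ord ltr0n.
  rewrite memv0; apply/eqP/sarkaria_sum_eq0.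
  by move=> i; rewrite !sum_lift_point; have [_ _ -> <-] := h i; have [_ _ -> <-] := h ord0.
case=> lam [l0 ls lp]; rewrite memv0 => /eqP/sarkaria_sum_eq0 lE.
pose S := \sum_k lam (k, ord0).
have SE i : \sum_k lam (k, i) = S /\
    \sum_k lam (k, i) *: p k = \sum_k lam (k, ord0) *: p k.
  have := lE i; rewrite !sum_lift_point => /eq_row_mx[-> /(congr1 (fun M : 'M_1 => M 0 0))].
  by rewrite !mxE eqxx !mulr1n.
have S0 : 0 < S.
  rewrite lt_def sumr_ge0 // andbT; apply/eqP => S0; move: lp.
  by rewrite sum_pairE big1 ?ltxx // => i _; rewrite (SE i).1.
exists (S^-1 *: \sum_k lam (k, ord0) *: p k) => i; exists (fun k => S^-1 * lam (k, i)); split.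
- by move=> k; rewrite mulr_ge0 // invr_ge0 ltW.
- by move=> k ki; rewrite ls ?mulr0 // inE.
- by rewrite -mulr_sumr (SE i).1 mulVf ?gt_eqF.
- by rewrite -(SE i).2 scaler_sumr; apply: eq_bigr => k _; rewrite scalerA.
Qed.

Lemma captures_class k : captures sarkaria 0%VS [set x : V | x.1 == k].
Proof.
exists (fun x => (x.1 == k)%:R); split.
- by move=> x; rewrite ler0n.
- by move=> x; rewrite inE => /negbTE->.
- by rewrite (bigD1 (k, ord0)) //= eqxx ltr_wpDr ?ltr01 // sumr_ge0.
by rewrite memv0; apply/eqP/sarkaria_sum_eq0.
Qed.

Lemma tver_vertexE (Y : W) :
  tver_vertex p Y = rainbow (@fst 'I_n 'I_r.+1) (graph Y) &&
    `[< captures sarkaria 0%VS (graph Y) >].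
Proof.
rewrite /tver_vertex; congr (_ && _); last by apply/asbool_equiv_eq/conv_capturesP.
apply/forallP/forallP => [h k|h i].
  apply/card_le1_eqP => -[k1 i1] [k2 i2]; rewrite !inE /=.
  move=> /andP[Y1 /eqP e1] /andP[Y2 /eqP e2]; rewrite e1 e2 in Y1 Y2 *.
  congr pair; apply/eqP; apply: contraT => ii.
  have := implyP (forallP (h i1) i2); rewrite eq_sym ii => /(_ isT)/pred0P/(_ k) /=.
  by rewrite Y1 Y2.
apply/forallP => i'; apply/implyP => ii; apply/pred0P => k /=; apply/negbTE/negP => /andP[Yi Yi'].
have /card_le1_eqP/(_ (k, i) (k, i')) := h k.
by rewrite !inE /= Yi Yi' eqxx => /(_ isT isT)/(congr1 snd)/= e; rewrite e eqxx in ii.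
Qed.

(** Subsets of rainbow sets are rainbow, so this condition is carried by the top of the chain alone;
    capturing passes only to larger sets and is asked of every member. *)
Lemma TverE (s : {set W}) :
  Tver p s = chains graph (fun sigma => `[< captures sarkaria 0%VS sigma >])
    (rainbow (@fst 'I_n 'I_r.+1)) s.
Proof.
rewrite /Tver /order_complex andbC /chains.
have -> : [forall u in s, forall v in s, tver_le u v || tver_le v u] = chain graph s.
  apply: eq_forallb => u; congr (_ ==> _); apply: eq_forallb => v.
  by rewrite !tver_le_graph.
case: (boolP (chain graph s)) => //= cs; apply/forall_inP/andP => [h|[/all_inP q /forallP h] u us].
  split; first by apply/all_inP => u /h; rewrite tver_vertexE => /andP[].
  apply/forallP => k; apply/card_le1_eqP => x y; rewrite !inE.
  move=> /andP[/bigcupP[u us xu] xk] /andP[/bigcupP[v vs yv] yk].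
  have [z [zs xz yz]] : exists z, [/\ z \in s, x \in graph z & y \in graph z].
    have /orP[/subsetP uv|/subsetP vu] := chainP _ _ cs u v us vs.
      by exists v; rewrite vs uv.
    by exists u; rewrite us xu vu.
  have := h z zs; rewrite tver_vertexE => /andP[/forallP/(_ k)/card_le1_eqP hz _].
  by apply: hz; rewrite inE ?xz ?yz inE.
rewrite tver_vertexE q // andbT; apply/forallP => k; apply: leq_trans (h k).
by rewrite subset_leq_card // setSI // sub_cup.
Qed.

(** The colours are the [n] points, and the Sarkaria vectors of [r.+1] parts live in a matrix space
    of dimension [r * (d + 1)]. *)
Lemma Tver_acyclic_below : acyclic_below (@Tver R d n r.+1 p) (n - (d + 1) * r).
Proof.
apply: (eq_acyclic_below (fun s => esym (TverE s))).
apply: (acyclic_below_rainbow ungraphK) => [|k|rho].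
- exact: captures_upset.
- exact/asboolP/captures_class.
have := @acyclic_below_captures R _ V sarkaria W graph ungraph ungraphK 0%VS rho.
by rewrite dimvf dimv0 subn0 dim_matrix mulnC.
Qed.

Lemma Tver_down (s t : {set W}) : s \subset t ->
  @Tver R d n r.+1 p t -> @Tver R d n r.+1 p s.
Proof.
move=> /subsetP st /andP[/forall_inP h1 /forall_inP h2]; apply/andP; split.
  by apply/forall_inP => u /st /h1.
by apply/forall_inP => u /st /h2 /forall_inP h; apply/forall_inP => v /st /h.
Qed.

End Tverberg.

Theorem theorem7p13 (R : realType) (d n : nat) (p : 'I_n -> 'rV[R]_d)
    (r m : nat) :
  injective p -> (1 <= r)%N ->
  ((d + 1) * (r - 1) + m + 1 <= n)%N ->
  forall j : int, -1 <= j <= m%:Z - 1 ->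
    reduced_homology_trivial (@Tver R d n r p) j.
Proof.
move=> _ r1 hn j /andP[j1 jm]; case: r r1 hn => // r _; rewrite subn1 /= => hn.
(* [j + 1] is nonnegative and at most [m], hence below [n - (d + 1) * r], with [r] now one less than
   the number of parts. *)
apply: (@acyclic_reduced_homology _ _ _ `|(j + 1)%R|%N); first exact: Tver_down.
  by lia.
by apply: Tver_acyclic_below; lia.
Qed.
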